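(* Let $K$ be a field, $S=K[x_1,\dots,x_n]$, $d\ge 2$, and ${\bf t}=(t_1,\dots,t_{d-1})$ a tuple of non-negative integers. Let $I\subseteq S$ be a ${\bf t}$-spread strongly stable ideal. Then $I$ has linear quotients; in particular, $I$ is componentwise linear.
   Context: $S=K[x_1,\dots,x_n]$ is standard graded over a field $K$. Monomials are written $u=x_{j_1}x_{j_2}\cdots x_{j_\ell}$ with $1\le j_1\le j_2\le\cdots\le j_\ell\le n$. Such a monomial of degree $\ell\le d$ is called ${\bf t}$-spread if $j_{i+1}-j_i\ge t_i$ for $i=1,\dots,\ell-1$. A ${\bf t}$-spread monomial ideal is an ideal generated by ${\bf t}$-spread monomials (so all its minimal generators have degree at most $d$). A ${\bf t}$-spread monomial ideal $I$ is ${\bf t}$-spread strongly stable if for every ${\bf t}$-spread monomial $u\in I$ and all $j<i$ such that $x_i$ divides $u$ and $x_j(u/x_i)$ is ${\bf t}$-spread, one has $x_j(u/x_i)\in I$. $G(I)$ denotes the unique minimal set of monomial generators of the monomial ideal $I$. Write $G(I)=\{u_1>u_2>\dots>u_m\}$, ordered decreasingly with respect to the pure lexicographic order (for distinct monomials, $x_1^{a_1}\cdots x_n^{a_n}>x_1^{b_1}\cdots x_n^{b_n}$ iff the leftmost non-zero entry of $(a_1-b_1,\dots,a_n-b_n)$ is positive). That $I$ has linear quotients means that, for this order of the generators, the colon ideal $(u_1,\dots,u_{k-1}):u_k$ is generated by variables for all $k=2,\dots,m$. $I$ is componentwise linear if for every $j$ the ideal generated by all homogeneous elements of degree $j$ of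 $I$ has a linear resolution. *)

(* Defs.v *)
From HB Require Import structures.
From mathcomp Require Import all_boot all_order all_algebra.
From mathcomp Require Import mpoly.

Set Implicit Arguments.
Unset Strict Implicit.
Unset Printing Implicit Defensive.

Import GRing.Theory.

Local Open Scope ring_scope.

(* The variables x_1, ..., x_n are indexed by 'I_n, i.e.     *)
(* x_(i+1) is 'X_i; a monomial is identified with its exponent vector         *)
(* m : 'X_{1..n}, the corresponding polynomial being 'X_[m].                  *)

Section Ideals.
Variables (n : nat) (K : fieldType).
Local Notation S := {mpoly K[n]}.

(* Ideals are Prop-valued sets of polynomials: the closedness predicate       *)
(* idealr_closed of ring_quotient would rule out the unit ideal.              *)
Definition ideal_span (A : S -> Prop) (f : S) : Prop :=
  exists2 s : seq (S * S),
    forall p, p \in s -> A p.2 & f = \sum_(p <- s) p.1 * p.2.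

Definition mon_ideal (M : 'X_{1..n} -> Prop) : S -> Prop :=
  ideal_span (fun f => exists2 m, M m & f = 'X_[m]).

Definition colon (J : S -> Prop) (u f : S) : Prop := J (f * u).

Definition generated_by_variables (J : S -> Prop) : Prop :=
  exists V : {set 'I_n},
    forall f, J f <-> ideal_span (fun g => exists2 i, i \in V & g = 'X_i) f.

Definition minimal_mon_gens (I : S -> Prop) (s : seq 'X_{1..n}) : Prop :=
  [/\ uniq s,
      forall f, I f <-> mon_ideal (fun m => m \in s) f &
      forall s' : seq 'X_{1..n}, {subset s' <= s} ->
        (forall f, I f <-> mon_ideal (fun m => m \in s') f) ->
        {subset s <= s'}].

End Ideals.

(* The order of 'X_{1..n} in mpoly is degree-lexicographic, hence not the     *)
(* pure lexicographic order used here.                                        *)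
Definition purelex_gt (n : nat) : rel 'X_{1..n} := fun a b =>
  [exists i : 'I_n,
    [forall j : 'I_n, (j < i)%N ==> (a j == b j)] && (b i < a i)%N].

Definition has_linear_quotients (n : nat) (K : fieldType)
    (I : {mpoly K[n]} -> Prop) : Prop :=
  exists s : seq 'X_{1..n},
    [/\ minimal_mon_gens I s,
        sorted (@purelex_gt n) s &
        forall k, (0 < k < size s)%N ->
          generated_by_variables
            (colon (@mon_ideal n K (fun m => m \in take k s))
                   'X_[nth 0%MM s k])].

Section Spread.
Variables (n : nat) (K : fieldType) (d : nat) (t : d.-1.-tuple nat).

(* The indices j_1 <= ... <= j_l with m = x_(j_1) ... x_(j_l), counted from 0 *)
(* (only their differences matter).                                           *)
Definition mon_indices (m : 'X_{1..n}) : seq nat :=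
  flatten [seq nseq (m i) (val i) | i <- enum 'I_n].

Definition tspread (m : 'X_{1..n}) : bool :=
  let s := mon_indices m in
  (size s <= d)%N &&
  [forall k : 'I_d.-1, (k.+1 < size s)%N ==>
     (nth 0 s k + tnth t k <= nth 0 s k.+1)%N].

Definition tspread_ideal (I : {mpoly K[n]} -> Prop) : Prop :=
  exists2 M : 'X_{1..n} -> Prop,
    forall m, M m -> tspread m & forall f, I f <-> mon_ideal M f.

Definition tspread_strongly_stable (I : {mpoly K[n]} -> Prop) : Prop :=
  tspread_ideal I /\
  forall (u : 'X_{1..n}) (i j : 'I_n),
    tspread u -> I 'X_[u] -> (j < i)%N -> (0 < u i)%N ->
    tspread (U_(j) + (u - U_(i)))%MM -> I 'X_[(U_(j) + (u - U_(i)))%MM].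

End Spread.

Section Resolutions.
Variables (n : nat) (K : fieldType).
Local Notation S := {mpoly K[n]}.

(* Data of ... -> F_2 -> F_1 -> F_0 -> S with F_i = \bigoplus_r S(- shift i r) *)
(* of rank rk i; elements of F_i are row vectors and the maps are             *)
(* v |-> v *m dif i (from F_(i+1) to F_i) and v |-> v *m aug.                 *)
Record graded_free_data := GradedFreeData {
  rk : nat -> nat;
  shift : forall i, 'I_(rk i) -> nat;
  aug : 'cV[S]_(rk 0);
  dif : forall i, 'M[S]_(rk i.+1, rk i)
}.

Definition degree_preserving (F : graded_free_data) : Prop :=
  (forall r, aug F r ord0 \is (shift r).-homog) /\
  (forall i (r : 'I_(rk F i.+1)) (c : 'I_(rk F i)),
     if (shift c <= shift r)%N
     then dif F i r c \is (shift r - shift c)%N.-homog : Prop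
     else dif F i r c = 0).

Definition graded_free_resolution (J : S -> Prop) (F : graded_free_data) :
    Prop :=
  [/\ degree_preserving F,
      forall f, J f <-> exists v : 'rV[S]_(rk F 0), (v *m aug F) ord0 ord0 = f,
      forall v : 'rV[S]_(rk F 0),
        v *m aug F = 0 <-> exists w : 'rV[S]_(rk F 1), w *m dif F 0 = v &
      forall i (v : 'rV[S]_(rk F i.+1)),
        v *m dif F i = 0 <-> exists w : 'rV[S]_(rk F i.+2), w *m dif F i.+1 = v].

(* The differentials are zero modulo the ideal (x_1, ..., x_n).               *)
Definition minimal_resolution (F : graded_free_data) : Prop :=
  forall i r c, (dif F i r c)@_0%MM = 0.

(* F_i = S(-j-i)^(rk i) for all i; the zero ideal qualifies for every j.      *)
Definition has_linear_resolution (j : nat) (J : S -> Prop) : Prop :=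
  exists F : graded_free_data,
    [/\ graded_free_resolution J F,
        minimal_resolution F &
        forall i (r : 'I_(rk F i)), shift r = (j + i)%N].

Definition component (I : S -> Prop) (j : nat) : S -> Prop :=
  ideal_span (fun f => I f /\ f \is j.-homog).

Definition componentwise_linear (I : S -> Prop) : Prop :=
  forall j, has_linear_resolution j (component I j).

End Resolutions.

(* Main.v *)
(* Linear quotients: write monomials as words in the variables.  Since I is
   strongly stable, if v and w are spread words with w in I and v_k <= w_k for
   every letter of w, then the prefix of v of the length of w is in I; so every
   spread word of I has a prefix in G(I).  If u > u' in G(I), the words first
   differ at letters y < x; replacing x by y in u' gives a spread word of I; its
   prefix c in G(I) must contain this y.  Hence c > u' and c : u' = x_y, and
   x_y divides u : u'.

   Linear resolutions: let g_1, ..., g_m be vectors over S, homogeneous of one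
   degree, such that each colon (g_1, ..., g_(k-1)) : g_k is generated by a set
   V_k of variables.  The linear relations x_p g_k = sum_(i < k) c_i g_i, p in
   V_k, ordered by k and then by p, generate the syzygies and again have colons
   generated by variables, because only the last entry x_p matters for the
   colon.  Iterating gives a linear resolution.

   Componentwise linearity: the degree-j monomials of an ideal with linear
   quotients u_1, ..., u_m again have linear quotients when they are ordered
   first by the least k such that u_k divides them, then lexicographically. *)
Require Import Defs.
From mathcomp Require Import all_boot all_order all_algebra.
From mathcomp Require Import mpoly.
From Stdlib Require Import ClassicalEpsilon.

Set Implicit Arguments.
Unset Strict Implicit.
Unset Printing Implicit Defensive.

Import GRing.Theory.
Local Open Scope ring_scope.

(** * Monomial ideals *)

Section MonomialIdeals.
Variables (n : nat) (K : fieldType).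
Local Notation S := {mpoly K[n]}.
Implicit Types (f g h : S) (M : 'X_{1..n} -> Prop).

Lemma ideal_spanD (A : S -> Prop) f g :
  ideal_span A f -> ideal_span A g -> ideal_span A (f + g).
Proof.
move=> [s sA ->] [s' s'A ->]; exists (s ++ s'); last by rewrite big_cat.
by move=> p; rewrite mem_cat => /orP[/sA|/s'A].
Qed.

Lemma ideal_spanMl (A : S -> Prop) f g : A g -> ideal_span A (f * g).
Proof.
move=> Ag; exists [:: (f, g)]; last by rewrite big_seq1.
by move=> p; rewrite inE => /eqP->.
Qed.

Lemma ideal_span_ext (A B : S -> Prop) f :
  (forall g, A g <-> B g) -> ideal_span A f <-> ideal_span B f.
Proof. by move=> AB; split=> -[s sA ->]; exists s => // p /sA /AB. Qed.

Lemma mon_idealP M f : mon_ideal M f <->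
  forall m, m \in msupp f -> exists2 m', M m' & (m' <= m)%MM.
Proof.
split=> [[s sM ->] m|fM].
  move=> /msupp_sum_le /flatten_mapP[p]; rewrite filter_predT => /sM[m' Mm' ->].
  rewrite (perm_mem (msuppMX _ _)) => /mapP[k _ ->].
  by exists m' => //; apply: lem_addr.
rewrite (mpolyE f) big_seq; elim/big_ind: _ => [||m /fM [m' Mm' m'm]].
- by exists [::]; rewrite ?big_nil.
- exact: ideal_spanD.
rewrite -(submK m'm) mpolyXD scalerAl.
by apply: ideal_spanMl; exists m'.
Qed.

Lemma mon_idealX M m :
  mon_ideal M ('X_[m] : S) <-> exists2 m', M m' & (m' <= m)%MM.
Proof.
rewrite mon_idealP; split=> [|mM k]; first by apply; rewrite msuppX inE.
by rewrite msuppX inE => /eqP->.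
Qed.

(** Membership in the ideal of the variables of [V], read off the support; [V] is a sequence so that
    variables can be added one at a time. *)
Definition in_vars (V : seq 'I_n) f : bool :=
  all (fun m : 'X_{1..n} => has (fun i => (0 < m i)%N) V) (msupp f).

Lemma in_varsP (V : seq 'I_n) f : reflect
  (forall m, m \in msupp f -> exists2 i, i \in V & (0 < m i)%N) (in_vars V f).
Proof.
by apply: (iffP allP) => fV m /fV /hasP.
Qed.

Lemma in_vars_ideal (V : seq 'I_n) f :
  in_vars V f <-> ideal_span (fun g => exists2 i, i \in [set i in V] & g = 'X_i) f.
Proof.
rewrite (@ideal_span_ext _
  (fun g => exists2 m, (exists2 i, i \in V & m = U_(i)%MM) & g = 'X_[m])); last first.
  move=> g; split=> [[i iV ->]|[m [i iV ->] ->]]; last by exists i; rewrite ?inE.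
  by exists U_(i)%MM => //; exists i => //; rewrite inE in iV.
rewrite -/(mon_ideal _ _) mon_idealP; split.
  move=> /in_varsP fV m /fV [i iV mi]; exists U_(i)%MM; first by exists i.
  by rewrite lep1mP -lt0n.
move=> fV; apply/in_varsP => m /fV [_ [i iV ->]].
by rewrite lep1mP -lt0n => mi; exists i.
Qed.

Lemma in_vars_nil f : in_vars [::] f = (f == (0 : S)).
Proof. by rewrite -msupp_eq0 /in_vars; case: (msupp f). Qed.

Lemma in_varsD V f g : in_vars V f -> in_vars V g -> in_vars V (f + g).
Proof.
move=> /in_varsP fV /in_varsP gV; apply/in_varsP => m /msuppD_le.
by rewrite mem_cat => /orP[/fV|/gV].
Qed.

Lemma in_vars_sub (V V' : seq 'I_n) f :
  {subset V <= V'} -> in_vars V f -> in_vars V' f.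
Proof.
move=> VV /in_varsP fV; apply/in_varsP => m /fV [i iV mi].
by exists i => //; apply: VV.
Qed.

(** The variable ['X_p] is a nonzerodivisor modulo the prime ideal generated by the variables of
    [V]. *)
Lemma in_varsMX V h p : p \notin V -> in_vars V (h * 'X_p) = in_vars V h.
Proof.
move=> pV; rewrite /in_vars (perm_all _ (msuppMX _ _)) all_map.
apply: eq_all => m /=; apply: eq_in_has => i iV.
rewrite mnmDE mnm1E; case: eqP => // ip.
by rewrite ip iV in pV.
Qed.

Lemma in_varsXM V h p : p \in V -> in_vars V (h * 'X_p).
Proof.
move=> pV; rewrite /in_vars (perm_all _ (msuppMX _ _)) all_map.
by apply/allP => m _ /=; apply/hasP; exists p; rewrite ?mnmDE ?mnm1E ?eqxx.
Qed.

(** The monomials of [f] divisible by ['X_p] go into [h]; each of the others must be divisible by a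
    variable of [V]. *)
Lemma in_vars_rcons V p f : in_vars (rcons V p) f ->
  exists f' h, f = f' + h * 'X_p /\ in_vars V f'.
Proof.
move=> /in_varsP fV.
pose Q (m : 'X_{1..n}) := (0 < m p)%N.
exists (\sum_(m <- msupp f | ~~ Q m) f@_m *: 'X_[m]).
exists (\sum_(m <- msupp f | Q m) f@_m *: 'X_[(m - U_(p))%MM]).
split.
  rewrite [LHS]mpolyE (bigID Q) /= addrC; congr (_ + _).
  rewrite big_distrl /=; apply: eq_bigr => m Qm.
  by rewrite -scalerAl -mpolyXD submK // lep1mP -lt0n.
rewrite big_seq_cond; elim/big_ind: _ => [||m /andP[/fV[i + mi] Qm]].
- by rewrite /in_vars msupp0.
- exact: in_varsD.
rewrite mem_rcons inE => /predU1P[ip|iV]; first by move: Qm; rewrite /Q -ip mi.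
by apply/in_varsP => k /msuppZ_le; rewrite msuppX inE => /eqP ->; exists i.
Qed.

Lemma dhomogXU (p : 'I_n) : ('X_p : S) \is 1.-homog.
Proof. by rewrite dhomogX; apply/eqP/mdeg1. Qed.

(** This lets the coefficients of a homogeneous relation be replaced by their components of the
    right degree. *)
Lemma pihomogM e k f g : g \is e.-homog ->
  pihomog mdeg (k + e) (f * g) = pihomog mdeg k f * g.
Proof.
move=> ge; rewrite {1 2}(mpolyE f) big_distrl !raddf_sum big_distrl /=.
apply: eq_bigr => m _; rewrite -scalerAl !linearZ /= -scalerAl; congr (_ *: _).
have me : 'X_[m] * g \is (mdeg m + e).-homog by rewrite dhomogM ?dhomogX.
rewrite pihomogX; have [<-|mk] := eqVneq (mdeg m) k; first by rewrite pihomog_dE.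
rewrite mul0r (pihomog_ne0 _ me) //.
by rewrite eqn_add2r.
Qed.

End MonomialIdeals.

(** * Linear resolutions from linear quotients *)

Section LinearQuotients.
Variables (n : nat) (K : fieldType).
Local Notation S := {mpoly K[n]}.

(** Stated for vectors because syzygies are vectors: [exists w, w *m A = f *: v] is membership of
    [f] in the colon of the row span of [A] by [v]. *)
Inductive linear_quotients (r : nat) : forall m, 'M[S]_(m, r) -> Prop :=
| LinQuotNil : linear_quotients (0 : 'M[S]_(0, r))
| LinQuotRcons m (A : 'M[S]_(m, r)) (v : 'rV[S]_r) (V : seq 'I_n) :
    linear_quotients A -> uniq V ->
    (forall f : S, (exists w : 'rV[S]_m, w *m A = f *: v) <-> in_vars V f) ->
    linear_quotients (col_mx A v).

Definition homog_mx e m r (A : 'M[S]_(m, r)) := forall i j, A i j \is e.-homog.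

Lemma homog_col_mx e m1 m2 r (A : 'M[S]_(m1, r)) (B : 'M[S]_(m2, r)) :
  homog_mx e (col_mx A B) <-> homog_mx e A /\ homog_mx e B.
Proof.
split=> [AB|[hA hB] i j]; last by rewrite mxE; case: split.
by split=> i j; [have := AB (lshift _ i) j|have := AB (rshift _ i) j];
   rewrite ?col_mxEu ?col_mxEd.
Qed.

Lemma homog_row_mx e m r1 r2 (A : 'M[S]_(m, r1)) (B : 'M[S]_(m, r2)) :
  homog_mx e A -> homog_mx e B -> homog_mx e (row_mx A B).
Proof. by move=> hA hB i j; rewrite mxE; case: split. Qed.

(** With [k = 1], this turns syzygies of [A] into syzygies of [col_mx A v] with last entry zero. *)
Lemma linear_quotients_row_mx0 r k m (A : 'M[S]_(m, r)) :
  linear_quotients A -> linear_quotients (row_mx A (0 : 'M_(m, k))).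
Proof.
elim=> {m A} [|m A v V _ IH uV AV]; first by rewrite row_mx0; exact: LinQuotNil.
have -> : row_mx (col_mx A v) 0 = col_mx (row_mx A 0) (row_mx v (0 : 'M_(1, k))).
  by rewrite -block_mxEv block_mxEh col_mx0.
apply: (LinQuotRcons IH uV) => f; rewrite -AV.
split=> -[w wA]; exists w.
  by move: wA; rewrite mul_mx_row scale_row_mx => /eq_row_mx[].
by rewrite mul_mx_row scale_row_mx wA mulmx0 scaler0.
Qed.

Lemma rV_rcons_ind m (P : 'rV[S]_(m + 1) -> Prop) :
  (forall (w : 'rV[S]_m) (f : S), P (row_mx w f%:M)) -> forall z, P z.
Proof. by move=> Pwf z; rewrite -[z]hsubmxK [rsubmx z]mx11_scalar. Qed.

(* A syzygy (w, f) of the rows of [col_mx A v] has its last entry f in the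
   colon ideal, so the syzygies with f in (x_i, i \in V') are those of A when
   V' is empty and gain one generator, of last entry x_p, with each p. *)
Lemma partial_syzygies e r m m' (A : 'M[S]_(m, r)) (v : 'rV[S]_r)
    (V : seq 'I_n) (B : 'M[S]_(m', m)) :
    homog_mx e A -> homog_mx e v ->
    (forall f : S, (exists w : 'rV[S]_m, w *m A = f *: v) <-> in_vars V f) ->
    linear_quotients B -> homog_mx 1 B ->
    (forall w : 'rV[S]_m, w *m A = 0 <-> exists z, z *m B = w) ->
  forall V' : seq 'I_n, uniq V' -> {subset V' <= V} ->
  exists k (C : 'M[S]_(k, m + 1)), [/\ linear_quotients C, homog_mx 1 C &
    forall (w : 'rV[S]_m) (f : S), (exists z, z *m C = row_mx w f%:M) <->
                w *m A + f *: v = 0 /\ in_vars V' f].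
Proof.
move=> hA hv AV lqB hB AB; elim/last_ind=> [_ _|V' p IH].
  exists m', (row_mx B 0); split=> [||w f].
  - exact: linear_quotients_row_mx0.
  - by apply: homog_row_mx => // i j; rewrite mxE dhomog0.
  rewrite in_vars_nil; split.
    move=> [z]; rewrite mul_mx_row mulmx0 => /eq_row_mx[zB f0].
    have -> : f = 0 by move/matrixP/(_ ord0 ord0): f0; rewrite !mxE mulr1n.
    by rewrite scale0r addr0 eqxx; split=> //; apply/AB; exists z.
  case=> + /eqP f0; have {f0}-> : f = 0 := f0; rewrite scale0r addr0 => /AB[z zB]; exists z.
  by rewrite mul_mx_row mulmx0 zB raddf0.
rewrite rcons_uniq => /andP[pV' uV'] sV'.
have pV : p \in V by apply: sV'; rewrite mem_rcons mem_head.
have [i iV'|k [C [lqC hC CP]]] := IH uV'.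
  by apply: sV'; rewrite mem_rcons inE iV' orbT.
(* The linear relation for ['X_p]: as [A] has degree [e] and ['X_p *: v] degree [1 + e], the degree
   one parts of the coefficients of any relation already form one. *)
have [c cA hc] : exists2 c : 'rV[S]_m, c *m A + 'X_p *: v = 0 & homog_mx 1 c.
  have [|w wA] := (AV 'X_p).2; first by rewrite -['X_p]mul1r; exact: in_varsXM.
  exists (\row_i - pihomog mdeg 1 (w ord0 i)) => [|i j]; last first.
    by rewrite mxE rpredN pihomogP.
  apply/matrixP => i j; move/matrixP/(_ i j): wA; rewrite !mxE => wA.
  move: (congr1 (pihomog mdeg (1 + e)) wA).
  rewrite raddf_sum /= [RHS]pihomog_dE; last first.
    by apply: dhomogM (hv i j); apply: dhomogXU.
  move=> <-; rewrite -big_split big1 //= => l _.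
  by rewrite !ord1 pihomogM // mxE mulNr addNr.
exists (k + 1)%N, (col_mx C (row_mx c ('X_p)%:M)); split=> [||w f].
(* The new row times [f] is a syzygy with last entry [f * 'X_p], so it is in the span of [C] iff
   [f * 'X_p], equivalently [f], lies in the ideal of [V']. *)
- apply: (LinQuotRcons lqC uV') => f.
  rewrite scale_row_mx scale_scalar_mx CP -(in_varsMX f pV').
  split=> [[] //|fV']; split=> //.
  by rewrite -scalemxAl -scalerA -scalerDr cA scaler0.
- apply/homog_col_mx; split=> //; apply: homog_row_mx => // i j.
  by rewrite mxE !ord1 eqxx mulr1n; apply: dhomogXU.
split.
  case; elim/rV_rcons_ind => z h; rewrite mul_row_col mul_scalar_mx.
  rewrite scale_row_mx scale_scalar_mx => zC.
  have /CP[wA fV] : exists z, z *m C = row_mx (w - h *: c) (f - h * 'X_p)%:M.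
    exists z; apply: (addIr (row_mx (h *: c) (h * 'X_p)%:M)).
    by rewrite zC add_row_mx subrK -raddfD subrK.
  split.
    rewrite -wA mulmxBl scalerBl -scalemxAl addrACA -opprD -scalerA -scalerDr.
    by rewrite cA scaler0 subr0.
  rewrite -[f](subrK (h * 'X_p)); apply: in_varsD.
    by apply: in_vars_sub fV => i iV; rewrite mem_rcons inE iV orbT.
  by rewrite in_varsXM // mem_rcons mem_head.
(* Conversely, [h] times the new row removes [h * 'X_p] from the last entry and leaves [f'] in the
   ideal of [V']. *)
move=> [wA /in_vars_rcons[f' [h [fE fV']]]].
have [|z zC] := (CP (w - h *: c) f').2.
  split=> //; move: wA; rewrite fE mulmxBl scalerDl -scalemxAl => <-.
  rewrite -[LHS]addr0 -(scaler0 _ h) -cA scalerDr scalerA.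
  by rewrite addrACA subrK.
exists (row_mx z h%:M); rewrite mul_row_col zC mul_scalar_mx scale_row_mx.
by rewrite scale_scalar_mx add_row_mx subrK -raddfD -fE.
Qed.

(** Taking [V' = V] in [partial_syzygies] loses nothing: the last entry of every syzygy lies in the
    colon ideal. *)
Lemma linear_syzygies e r m (A : 'M[S]_(m, r)) :
  linear_quotients A -> homog_mx e A ->
  exists k (B : 'M[S]_(k, m)), [/\ linear_quotients B, homog_mx 1 B &
    forall w : 'rV[S]_m, w *m A = 0 <-> exists z, z *m B = w].
Proof.
elim=> {m A} [_|m A v V lqA IH uV AV /homog_col_mx[hA hv]].
  exists 0%N, 0; split=> [|[]//|w]; first exact: LinQuotNil.
  by rewrite [w]thinmx0 mul0mx; split=> // _; exists 0; rewrite mul0mx.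
have [k [B [lqB hB BP]]] := IH hA.
have [l [C [lqC hC CP]]] :=
  partial_syzygies hA hv AV lqB hB BP uV (fun _ => id).
exists l, C; split=> //; elim/rV_rcons_ind => w f.
rewrite CP mul_row_col mul_scalar_mx; split=> [wA|[] //]; split=> //.
apply/AV; exists (- w); rewrite mulNmx; apply/eqP.
by rewrite eq_sym -addr_eq0 addrC wA.
Qed.

(** Matrix sizes vary along the resolution; packing them with the matrix makes the syzygy
    construction a map of one type that can be iterated. *)
Record stage := Stage {
  stage_cols : nat;
  stage_rows : nat;
  stage_mx : 'M[S]_(stage_rows, stage_cols);
  stage_deg : nat;
  stage_lq : linear_quotients stage_mx;
  stage_homog : homog_mx stage_deg stage_mx }.

(** Indefinite description turns the existence statement into data, from which the differentials are
    built by recursion. *)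
Lemma next_stage (s : stage) :
  {k : nat & {B : 'M[S]_(k, stage_rows s) | [/\ linear_quotients B, homog_mx 1 B &
    forall w : 'rV[S]_(stage_rows s),
       w *m stage_mx s = 0 <-> exists z, z *m B = w]}}.
Proof.
have := linear_syzygies (@stage_lq s) (@stage_homog s).
move=> /constructive_indefinite_description[k].
move=> /constructive_indefinite_description[B sB].
by exists k; exists B.
Qed.

Definition syz_stage (s : stage) : stage :=
  let B := projT2 (next_stage s) in
  @Stage (stage_rows s) (projT1 (next_stage s)) (sval B) 1
    (let: And3 lqB _ _ := svalP B in lqB) (let: And3 _ hB _ := svalP B in hB).

Lemma syz_stageP (s : stage) (w : 'rV[S]_(stage_rows s)) :
  w *m stage_mx s = 0 <-> exists z, z *m stage_mx (syz_stage s) = w.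
Proof. by have [_ _] := svalP (projT2 (next_stage s)); apply. Qed.

Lemma linear_quotients_resolution e m (A : 'M[S]_(m, 1)) (J : S -> Prop) :
  linear_quotients A -> homog_mx e A ->
  (forall f, J f <-> exists w : 'rV[S]_m, w *m A = f%:M) ->
  has_linear_resolution e J.
Proof.
move=> lqA hA JA; pose s i := iter i syz_stage (Stage lqA hA).
pose F := @GradedFreeData n K (fun i => stage_rows (s i))
  (fun i _ => (e + i)%N) (stage_mx (s 0%N)) (fun i => stage_mx (s i.+1)).
have hdif i : homog_mx 1 (dif F i).
  by move=> r c; apply: (@stage_homog (s i.+1)).
(* Entries homogeneous of degree one have no constant term, hence minimality. *)
exists F; split=> [|i r c|//]; last first.
  apply: (@dhomog_nemf_coeff _ _ mdeg 1 _ _ (hdif i r c)).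
  by have: @mdeg n 0%MM != 1%N by rewrite mdeg0.
split.
- split=> [r|i r c]; first by rewrite /= addn0; apply: hA.
  by rewrite leq_add2l leqnSn subnDl subSnn; apply: hdif.
- move=> f; rewrite JA; split=> -[v vA]; exists v.
    by rewrite -[aug F]/A vA mxE mulr1n.
  by rewrite [LHS]mx11_scalar -vA.
- exact: (@syz_stageP (s 0%N)).
- by move=> i; apply: (@syz_stageP (s i.+1)).
Qed.

End LinearQuotients.

(** * Ideals generated by lists of monomials with linear quotients *)

Section MonomialQuotients.
Variables (n : nat) (K : fieldType).
Local Notation S := {mpoly K[n]}.
Implicit Types (a b c u : 'X_{1..n}) (s : seq 'X_{1..n}).

(** The inequality says that ['X_p] divides the generator a / gcd(a, u) of the colon ideal, and [c]
    puts ['X_p] into that ideal. *)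
Definition colon_vars s u :=
  forall a, a \in s -> exists p : 'I_n, (u p < a p)%N /\
    exists2 c, c \in s & (c <= U_(p) + u)%MM.

Definition quotient_list s :=
  forall k, (k < size s)%N -> colon_vars (take k s) (nth 0%MM s k).

Lemma colon_varsP s u : colon_vars s u ->
  exists2 V : seq 'I_n, uniq V & forall f : S,
    mon_ideal (fun m => m \in s) (f * 'X_[u]) <-> in_vars V f.
Proof.
move=> su; pose V := [seq p <- enum 'I_n | has (fun c => (c <= U_(p) + u)%MM) s].
exists V => [|f]; first by rewrite filter_uniq ?enum_uniq.
rewrite mon_idealP; split=> [fs|/in_varsP fV m].
  apply/in_varsP => m mf; have [|a sa am] := fs (u + m)%MM.
    by rewrite (perm_mem (msuppMX _ _)) map_f.
  have [p [up [c sc cp]]] := su a sa; exists p.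
    by rewrite mem_filter mem_enum andbT; apply/hasP; exists c.
  (* If ['X_p] did not divide [m], then [a] dividing [u + m] would give [a p <= u p]. *)
  by move/mnm_lepP/(_ p): am; rewrite mnmDE; move: up; case: (m p) => //; rewrite addn0 ltnNge => /negP.
rewrite (perm_mem (msuppMX _ _)) => /mapP[k /fV[p]].
rewrite mem_filter => /andP[/hasP[c sc cp] _] kp ->; exists c => //.
apply: lepm_trans cp _; apply/mnm_lepP => i.
by rewrite !mnmDE mnm1E addnC leq_add2l; case: eqP => // <-.
Qed.

Lemma quotient_list_rcons s u :
  quotient_list (rcons s u) -> quotient_list s /\ colon_vars s u.
Proof.
move=> su; split=> [k ks|]; last first.
  have := su (size s); rewrite size_rcons nth_rcons ltnn eqxx -cats1.
  by rewrite take_size_cat //; apply.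
have := su k; rewrite size_rcons nth_rcons ks -cats1 takel_cat ?(ltnW ks) //.
by apply; apply: ltnW.
Qed.

Lemma quotient_list_mx j s :
  quotient_list s -> {in s, forall m, mdeg m = j} ->
  exists m (A : 'M[S]_(m, 1)), [/\ linear_quotients A, homog_mx j A &
    forall f, mon_ideal (fun m => m \in s) f <->
              exists w : 'rV[S]_m, w *m A = f%:M].
Proof.
elim/last_ind: s => [_ _|s u IH /quotient_list_rcons[qs su] degs].
  exists 0%N, 0; split=> [|[]//|f]; first exact: LinQuotNil.
  rewrite mon_idealP; split=> [f0|[w /matrixP/(_ ord0 ord0)]].
    exists 0; have -> : f = 0.
      apply/eqP; rewrite -msupp_eq0; case: (msupp f) f0 => // m l /(_ m).
      by rewrite mem_head => -[].
    by rewrite mul0mx raddf0.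
  by rewrite mulmx0 !mxE mulr1n => <- m; rewrite msupp0.
have [m sm|k [A [lqA hA AP]]] := IH qs.
  by apply: degs; rewrite mem_rcons inE sm orbT.
have [V uV VP] := colon_varsP su.
exists (k + 1)%N, (col_mx A ('X_[u])%:M); split=> [||f].
- apply: (LinQuotRcons lqA uV) => f.
  by rewrite -VP AP scale_scalar_mx.
- apply/homog_col_mx; split=> // i i'.
  rewrite mxE !ord1 eqxx mulr1n dhomogX; apply/eqP/degs.
  by rewrite mem_rcons mem_head.
split=> [[l lP ->]|[z]]; last first.
  elim/rV_rcons_ind: z => w h; rewrite mul_row_col mul_scalar_mx.
  rewrite scale_scalar_mx [w *m A]mx11_scalar => wA.
  have -> : f = (w *m A) ord0 ord0 + h * 'X_[u].
    move/matrixP/(_ ord0 ord0): wA; rewrite -raddfD.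
    by rewrite [LHS]mxE [RHS]mxE !mulr1n => <-.
  apply: ideal_spanD; last first.
    by apply: ideal_spanMl; exists u; rewrite ?mem_rcons ?mem_head.
  have /AP : exists w' : 'rV[S]_k, w' *m A = ((w *m A) ord0 ord0)%:M.
    by exists w; rewrite -mx11_scalar.
  move/mon_idealP => sA; apply/mon_idealP => m /sA[m' sm' mm']; exists m' => //.
  by rewrite mem_rcons inE sm' orbT.
rewrite big_seq; elim/big_ind: _ => [|g h [z zg] [z' zh]|[h g] /lP[m sm /= ->]].
- by exists 0; rewrite mul0mx raddf0.
- by exists (z + z'); rewrite mulmxDl zg zh raddfD.
move: sm; rewrite mem_rcons inE => /predU1P[->|sm].
  exists (row_mx 0 h%:M).
  by rewrite mul_row_col mul0mx add0r mul_scalar_mx scale_scalar_mx.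
have /AP[w wA] : mon_ideal (fun m => m \in s) (h * 'X_[m]).
  by apply: ideal_spanMl; exists m.
by exists (row_mx w 0); rewrite mul_row_col mul0mx addr0.
Qed.

Lemma quotient_list_resolution j s (J : S -> Prop) :
  quotient_list s -> {in s, forall m, mdeg m = j} ->
  (forall f, J f <-> mon_ideal (fun m => m \in s) f) ->
  has_linear_resolution j J.
Proof.
move=> qs degs Js; have [m [A [lqA hA AP]]] := quotient_list_mx qs degs.
by apply: (linear_quotients_resolution lqA hA) => f; rewrite Js.
Qed.

(** In a strictly sorted list the prefix before [u] consists of the members [c] with [R c u], so
    positions can be replaced by the order. *)
Lemma quotient_list_sorted (R : rel 'X_{1..n}) s :
    irreflexive R -> transitive R -> sorted R s ->
    (forall a u, a \in s -> u \in s -> R a u -> exists p : 'I_n, (u p < a p)%N /\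
       exists c, [/\ c \in s, R c u & (c <= U_(p) + u)%MM]) ->
  quotient_list s.
Proof.
move=> irrR trR sR H k ks a aks.
have su : nth 0%MM s k \in s by rewrite mem_nth.
have takeR c : c \in s -> (c \in take k s) = R c (nth 0%MM s k).
  move=> sc; rewrite in_take_leq ?(ltnW ks) //.
  have cs : (index c s < size s)%N by rewrite index_mem.
  rewrite -{2}(nth_index 0%MM sc); case: ltngtP => [ck|kc|<-].
  - by rewrite (sorted_ltn_nth trR 0%MM sR).
  - have := sorted_ltn_nth trR 0%MM sR _ _ ks cs kc => ukc.
    by apply/esym/negP => /(trR _ _ _ ukc); rewrite irrR.
  - by rewrite irrR.
have sa : a \in s by apply: mem_take aks.
rewrite takeR // in aks.
have [p [up [c [sc Rc cp]]]] := H a _ sa su aks.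
by exists p; split=> //; exists c; rewrite ?takeR.
Qed.

End MonomialQuotients.

(** * Components of an ideal with linear quotients *)

Lemma strict_sort (T : eqType) (R : rel T) (s : seq T) :
  transitive R -> (forall x y, x != y -> R x y || R y x) ->
  exists2 s', sorted R s' & s' =i s.
Proof.
move=> trR totR; pose leR x y := (x == y) || R x y.
have trle : transitive leR.
  move=> y x z /orP[/eqP->//|xy] /orP[/eqP<-|yz]; rewrite /leR ?xy ?orbT //.
  by rewrite (trR _ _ _ xy yz) orbT.
have totle : total leR.
  move=> x y; rewrite /leR [y == x]eq_sym.
  by case: eqVneq => //= /totR.
exists (sort leR (undup s)) => [|x]; last by rewrite mem_sort mem_undup.
have := sort_sorted totle (undup s); rewrite !sorted_pairwise // => lep.
have : uniq (sort leR (undup s)) by rewrite sort_uniq undup_uniq.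
rewrite uniq_pairwise => neq.
have : pairwise [rel x y | leR x y && (x != y)] (sort leR (undup s)).
  by rewrite (pairwise_relI leR [rel x y | x != y]) lep.
by apply: sub_pairwise => x y /andP[/orP[->//|]].
Qed.

(** * The pure lexicographic order, divisibility and degree of monomials *)

Section PureLex.
Variable n : nat.
Implicit Types a b c u m : 'X_{1..n}.

Lemma purelexP a b : reflect
  (exists2 i : 'I_n, forall j : 'I_n, (j < i)%N -> a j = b j & (b i < a i)%N)
  (purelex_gt a b).
Proof.
apply: (iffP existsP) => [[i /andP[/forallP ab bi]]|[i ab bi]]; exists i => //.
  by move=> j ji; apply/eqP; apply: (implyP (ab j)).
by rewrite bi andbT; apply/forallP => j; apply/implyP => /ab ->.
Qed.

Lemma purelex_irr : irreflexive (@purelex_gt n).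
Proof. by move=> a; apply/purelexP => -[i _]; rewrite ltnn. Qed.

Lemma purelex_trans : transitive (@purelex_gt n).
Proof.
move=> b a c /purelexP[i ab bi] /purelexP[k bc ck]; apply/purelexP.
case: (ltngtP i k) => [ik|ki|/val_inj ik].
- exists i => [j ji|]; last by rewrite -bc.
  by rewrite ab // bc // (ltn_trans ji).
- exists k => [j jk|]; last by rewrite ab.
  by rewrite ab ?bc // (ltn_trans jk).
- subst k; exists i => [j ji|]; last exact: ltn_trans bi.
  by rewrite ab ?bc.
Qed.

Lemma purelex_total a b : a != b -> purelex_gt a b || purelex_gt b a.
Proof.
move=> ab; have [i abi]: exists i, a i != b i.
  apply/existsP; apply: contraR ab; rewrite negb_exists => /forallP ab.
  by apply/eqP/mnmP => i; apply/eqP; have := ab i; rewrite negbK.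
case: (@arg_minnP _ i (fun i => a i != b i) (@nat_of_ord n) abi) => k abk mink.
have eqab (j : 'I_n) : (j < k)%N -> a j = b j.
  by move=> jk; apply/eqP; apply: contraTT jk => /mink; rewrite leqNgt.
move: abk; rewrite neq_ltn => /orP[abk|abk]; apply/orP; [right|left].
  by apply/purelexP; exists k => // j /eqab.
by apply/purelexP; exists k.
Qed.

Lemma lem_mdeg a b : (a <= b)%MM -> (mdeg a <= mdeg b)%N.
Proof. by move=> ab; rewrite -(submK ab) mdegD leq_addl. Qed.

Lemma lem_mdeg_eq a b : (a <= b)%MM -> (mdeg b <= mdeg a)%N -> a = b.
Proof.
move=> ab; rewrite -{1 2}(submK ab) mdegD -{2}[mdeg a]add0n leq_add2r leqn0.
by rewrite mdeg_eq0 => /eqP ->; rewrite add0m.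
Qed.

Lemma lemPn a b : ~~ (a <= b)%MM -> exists i, (b i < a i)%N.
Proof.
by rewrite negb_forall => /existsP[i abi]; exists i; rewrite ltnNge.
Qed.

Lemma lem_step a b : (a <= b)%MM -> (mdeg a < mdeg b)%N ->
  exists2 q : 'I_n, (0 < b q)%N & (a <= b - U_(q))%MM.
Proof.
move=> ab degab; have /lemPn[q aq] : ~~ (b <= a)%MM.
  by apply: contraL degab => /lem_mdeg; rewrite leqNgt.
exists q; first by apply: leq_ltn_trans aq.
apply/mnm_lepP => i; rewrite mnmBE mnm1E; move/mnm_lepP/(_ i): ab.
case: eqP => [<- _|_]; last by rewrite subn0.
by rewrite subn1 -ltnS prednK // (leq_ltn_trans _ aq).
Qed.

Lemma mdeg_subU a (q : 'I_n) : (0 < a q)%N -> (mdeg (a - U_(q))).+1 = mdeg a.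
Proof.
rewrite lt0n -lep1mP => qa.
by rewrite -[in RHS](submK qa) mdegD mdeg1 addn1.
Qed.

Definition mons_of_degree (j : nat) : seq 'X_{1..n} :=
  [seq m <- [seq bmnm x | x <- enum {: 'X_{1..n < j.+1}}] | mdeg m == j].

Lemma mem_mons_of_degree j m : (m \in mons_of_degree j) = (mdeg m == j).
Proof.
rewrite mem_filter andb_idr // => /eqP mj.
have lm : (mdeg m < j.+1)%N by rewrite mj.
by apply/mapP; exists (BMultinom lm); rewrite ?mem_enum.
Qed.

End PureLex.

(** * Linear quotients for the monomials of one degree *)

Section Component.
Variables (n : nat) (K : fieldType).
Local Notation S := {mpoly K[n]}.
Variable s : seq 'X_{1..n}.
Hypothesis anti_s : {in s &, forall a b : 'X_{1..n}, (a <= b)%MM -> a = b}.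
Hypothesis quot_s : quotient_list s.

Definition first_gen (m : 'X_{1..n}) := find (fun u : 'X_{1..n} => (u <= m)%MM) s.

Definition component_gt (a b : 'X_{1..n}) :=
  (first_gen a < first_gen b)%N ||
  (first_gen a == first_gen b) && purelex_gt a b.

Definition divisible (m : 'X_{1..n}) := has (fun u : 'X_{1..n} => (u <= m)%MM) s.

Lemma component_gt_irr : irreflexive component_gt.
Proof. by move=> a; rewrite /component_gt ltnn purelex_irr andbF. Qed.

Lemma component_gt_trans : transitive component_gt.
Proof.
move=> b a c /orP[ab|/andP[/eqP ab lab]] /orP[bc|/andP[/eqP bc lbc]].
- by apply/orP; left; apply: ltn_trans bc.
- by apply/orP; left; rewrite -bc.
- by apply/orP; left; rewrite ab.
- by apply/orP; right; rewrite ab bc eqxx (purelex_trans lab).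
Qed.

Lemma component_gt_total a b : a != b -> component_gt a b || component_gt b a.
Proof. by rewrite /component_gt => /purelex_total; case: ltngtP. Qed.

(* With u the first generator dividing b: if a has an earlier first generator,
   the variable supplied for a by the colon ideal at u cannot divide b / u, so
   it still separates a from b; otherwise exchange a variable of b / u. *)
Lemma component_gt_quotient j (a b : 'X_{1..n}) :
    divisible a -> mdeg a = j -> divisible b -> mdeg b = j -> component_gt a b ->
  exists p : 'I_n, (b p < a p)%N /\
    exists c, [/\ divisible c /\ mdeg c = j, component_gt c b & (c <= U_(p) + b)%MM].
Proof.
move=> sa dega sb degb; set k := first_gen b; set u := nth 0%MM s k.
have ub : (u <= b)%MM := nth_find 0%MM sb.
have ks : (k < size s)%N by rewrite -has_find.
have su : u \in s by apply: mem_nth.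
have degU p m : mdeg (U_(p) + m : 'X_{1..n}) = (mdeg m).+1 by rewrite mdegD mdeg1.
case/orP=> [ak|/andP[/eqP ak /purelexP[p abp bp]]].
  pose v := nth 0%MM s (first_gen a).
  have va : (v <= a)%MM := nth_find 0%MM sa.
  have vk : v \in take k s.
    rewrite in_take_leq ?(ltnW ks) //.
    by apply: leq_ltn_trans (ak); apply/index_nth/(ltn_trans ak).
  have [p [up [c ck cp]]] := quot_s ks vk.
  have firstc m : (c <= m)%MM -> divisible m /\ (first_gen m < k)%N.
    move=> cm; have : has (fun u : 'X_{1..n} => (u <= m)%MM) (take k s).
      by apply/hasP; exists c.
    move=> /[dup]; rewrite {2}has_take_leq ?(ltnW ks) // => hk ->; split=> //.
    by apply/hasP; exists c; rewrite // (mem_take ck).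
  (* Otherwise x_p u, and with it [c], divides [b], which then has a generator before [u]. *)
  have bu : b p = u p.
    apply/eqP; rewrite eqn_leq (mnm_lepP ub) andbT leqNgt; apply/negP => bp.
    have /firstc[_] : (c <= b)%MM; last by rewrite ltnn.
    apply: lepm_trans cp _; apply/mnm_lepP => i; rewrite mnmDE mnm1E.
    by case: eqP => [<-|_]; rewrite ?add0n ?add1n // (mnm_lepP ub).
  exists p; split; first by rewrite bu (leq_trans up) // (mnm_lepP va).
  have cpb : (c <= U_(p) + b)%MM.
    apply: lepm_trans cp _; apply/mnm_lepP => i.
    by rewrite !mnmDE leq_add2l (mnm_lepP ub).
  (* A larger degree of [c] would force [c = U_(p) + u], a proper multiple of [u], against
     [anti_s]. *)
  have degc : (mdeg c < mdeg (U_(p) + b)%MM)%N.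
    rewrite degU ltnS leqNgt; apply/negP => degc.
    have cE : c = (U_(p) + u)%MM.
      apply: lem_mdeg_eq => //; rewrite degU (leq_trans _ degc) // ltnS.
      exact: lem_mdeg.
    have /(anti_s su (mem_take ck)) uc : (u <= c)%MM by rewrite cE lem_addl.
    by have := degU p u; rewrite -cE -uc => /eqP; rewrite ltn_eqF.
  (* Dropping a variable that [c] does not need brings x_p b back to degree [j]. *)
  have [q bq cq] := lem_step cpb degc.
  have [dc kc] := firstc _ cq.
  exists (U_(p) + b - U_(q))%MM; split.
  - by split=> //; apply: succn_inj; rewrite mdeg_subU // degU degb.
  - by rewrite /component_gt kc.
  - exact: lem_subr.
have [q aq] : exists q, (a q < b q)%N.
  apply: lemPn; apply/negP => ba.
  by move: bp; rewrite (lem_mdeg_eq ba) ?ltnn // dega degb.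
have pq : (p < q)%N.
  rewrite ltn_neqAle; apply/andP; split.
    by apply: contraTneq aq => /val_inj <-; rewrite -leqNgt ltnW.
  by rewrite leqNgt; apply/negP => /abp aqE; rewrite aqE ltnn in aq.
have neq (r i : 'I_n) : (i < r)%N -> (r == i) = false.
  by move=> ir; apply: gtn_eqF.
exists p; split=> //; set c := (U_(p) + (b - U_(q)))%MM; exists c.
(* The exchange keeps [u] as a divisor: [u] also divides [a], so [u q <= a q < b q]. *)
have uc : (u <= c)%MM.
  apply/mnm_lepP => i; rewrite mnmDE mnmBE !mnm1E.
  apply: leq_trans (leq_addl _ _); case: eqP => [<-|_]; last first.
    by rewrite subn0 (mnm_lepP ub).
  have ua : (u <= a)%MM by rewrite /u /k -ak; apply: (nth_find 0%MM sa).
  by rewrite subn1 -ltnS prednK ?(leq_ltn_trans _ aq) // (mnm_lepP ua).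
have dc : divisible c by apply/hasP; exists u.
split; first split=> //.
- by rewrite -degb degU mdeg_subU // (leq_ltn_trans _ aq).
(* Since [u] divides [c], the first generator of [c] comes no later than [u]; if it is [u], then
   [p < q] decides the lexicographic comparison. *)
- have : has (fun u : 'X_{1..n} => (u <= c)%MM) (take k.+1 s).
    apply/hasP; exists u => //; rewrite in_take_leq // ltnS.
    exact: index_nth.
  rewrite has_take_leq // ltnS leq_eqVlt /component_gt => /orP[/eqP kc|-> //].
  apply/orP; right; rewrite [first_gen c]kc eqxx; apply/purelexP; exists p.
    move=> i ip; rewrite mnmDE mnmBE !mnm1E.
    by rewrite (neq _ _ ip) (neq _ _ (ltn_trans ip pq)) add0n subn0.
  by rewrite mnmDE mnmBE !mnm1E eqxx (neq _ _ pq) subn0.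
- apply/mnm_lepP => i; rewrite !mnmDE mnmBE leq_add2l leq_subr //.
Qed.

Lemma component_linear_resolution (I : S -> Prop) j :
  (forall f, I f <-> mon_ideal (fun m => m \in s) f) ->
  has_linear_resolution j (component I j).
Proof.
move=> Is.
have [w sw ws] := strict_sort [seq m <- mons_of_degree n j | divisible m]
  component_gt_trans component_gt_total.
have wP m : (m \in w) = divisible m && (mdeg m == j).
  by rewrite ws mem_filter mem_mons_of_degree.
apply: (@quotient_list_resolution _ _ _ w) => [|m|f].
- apply: quotient_list_sorted component_gt_irr component_gt_trans sw _.
  move=> a b; rewrite !wP => /andP[sa /eqP da] /andP[sb /eqP db] ab.
  have [p [bp [c [[dc degc] cb cp]]]] := component_gt_quotient sa da sb db ab.
  by exists p; split=> //; exists c; rewrite wP dc degc eqxx.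
- by rewrite wP => /andP[_ /eqP].
split=> -[l lP ->].
  apply/mon_idealP => m /msupp_sum_le /flatten_mapP[p].
  rewrite filter_predT => /lP[/Is/mon_idealP sp /dhomogP degp].
  move=> /msuppM_le /allpairsP[[m1 m2] /= [_ m2p ->]].
  exists m2; last exact: lem_addl.
  have [u su um] := sp _ m2p; rewrite wP (degp _ m2p) eqxx andbT.
  by apply/hasP; exists u.
exists l => // p /lP[m]; rewrite wP => /andP[/hasP[u su um] degm] ->.
split; last by rewrite dhomogX.
by apply/Is/mon_idealX; exists u.
Qed.

End Component.

(** * Spread words *)

Section Words.
Variable n : nat.
Implicit Types (w v p q : seq 'I_n) (m a : 'X_{1..n}).

Definition mon_of w : 'X_{1..n} := (\sum_(i <- w) U_(i))%MM.

Definition word m : seq 'I_n := flatten [seq nseq (m i) i | i <- enum 'I_n].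

Lemma mon_ofE w i : mon_of w i = count_mem i w.
Proof.
rewrite mnm_sumE; elim: w => [|x w IH]; first by rewrite big_nil.
by rewrite big_cons IH mnm1E.
Qed.

Lemma mon_of_cat w v : mon_of (w ++ v) = (mon_of w + mon_of v)%MM.
Proof. by rewrite /mon_of big_cat. Qed.

Lemma mon_of_cons i w : mon_of (i :: w) = (U_(i) + mon_of w)%MM.
Proof. by rewrite /mon_of big_cons. Qed.

Lemma mon_of_prefix w v : (mon_of w <= mon_of (w ++ v))%MM.
Proof. by rewrite mon_of_cat lem_addr. Qed.

Lemma mdeg_mon_of w : mdeg (mon_of w) = size w.
Proof.
elim: w => [|i w IH]; first by rewrite /mon_of big_nil mdeg0.
by rewrite mon_of_cons mdegD mdeg1 IH.
Qed.

Lemma count_word m i : count_mem i (word m) = m i.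
Proof.
rewrite count_flatten sumnE 2!big_map big_enum /= (bigD1 i) //= count_nseq /=.
rewrite eqxx mul1n big1 ?addn0 // => j ji.
by rewrite count_nseq /= (negPf ji).
Qed.

Lemma word_mon m : mon_of (word m) = m.
Proof. by apply/mnmP => i; rewrite mon_ofE count_word. Qed.

Lemma mon_indices_word m : mon_indices m = map val (word m).
Proof.
rewrite /mon_indices /word; elim: (enum 'I_n) => //= i l ->.
by rewrite map_cat map_nseq.
Qed.

Lemma sorted_word m : sorted leq (map val (word m)).
Proof.
rewrite sorted_pairwise; last exact: leq_trans.
have: pairwise leq (map val (enum 'I_n)).
  by rewrite val_enum_ord -sorted_pairwise ?iota_sorted //; exact: leq_trans.
rewrite /word; elim: (enum 'I_n) => //= i l IH /andP[il /IH {}IH].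
rewrite map_cat pairwise_cat IH andbT map_nseq; apply/andP; split.
  apply/allrelP => x y /nseqP[-> _] /mapP[z /flatten_mapP[j jl /nseqP[-> _]] ->].
  by apply: (allP il); rewrite map_f.
by elim: (m i) => //= k ->; rewrite andbT; apply/allP => x /nseqP[->].
Qed.

Lemma word_mon_of w : sorted leq (map val w) -> word (mon_of w) = w.
Proof.
move=> sw; apply: (inj_map val_inj).
apply: (sorted_eq leq_trans anti_leq (sorted_word _) sw).
by apply: perm_map; apply/allP => i _ /=; rewrite count_word mon_ofE.
Qed.

(** Comparing letter counts gives a subsequence of [w] that is a permutation of [word m]; both are
    sorted, hence equal. *)
Lemma subseq_word m w : sorted leq (map val w) -> (m <= mon_of w)%MM ->
  subseq (word m) w.
Proof.
move=> sw mw; have [|w' w'w ww'] := (count_subseqP (word m) w).1.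
  by move=> i; rewrite count_word -mon_ofE (mnm_lepP mw).
suff -> : word m = w' by [].
apply: (inj_map val_inj).
apply: (sorted_eq leq_trans anti_leq (sorted_word _)); last exact: perm_map.
by apply: subseq_sorted sw; [exact: leq_trans|exact: map_subseq].
Qed.

(** By sortedness neither tail has a letter smaller than its first one, so [y] is the smallest index
    at which the exponents differ. *)
Lemma purelex_mon_of h (x y : 'I_n) q q' :
    sorted leq (map val (h ++ x :: q)) -> sorted leq (map val (h ++ y :: q')) ->
    (y < x)%N ->
  (mon_of (h ++ x :: q) y < mon_of (h ++ y :: q') y)%N /\
  purelex_gt (mon_of (h ++ y :: q')) (mon_of (h ++ x :: q)).
Proof.
have count0 (z i : 'I_n) l : sorted leq (map val (h ++ z :: l)) -> (i < z)%N ->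
    count_mem i (z :: l) = 0%N.
  rewrite map_cat sorted_pairwise; last exact: leq_trans.
  rewrite pairwise_cat /= => /and3P[_ _ /andP[zl _]] iz.
  rewrite -val_eqE /= gtn_eqF //; apply/count_memPn/negP => il.
  by have := allP zl i (map_f val il); rewrite leqNgt iz.
move=> sx sy yx.
have lt_y : (mon_of (h ++ x :: q) y < mon_of (h ++ y :: q') y)%N.
  rewrite !mon_ofE !count_cat (count0 _ _ _ sx yx) addn0 /= eqxx.
  by rewrite addnS ltnS leq_addr.
split=> //; apply/purelexP; exists y => // i iy.
rewrite !mon_ofE !count_cat (count0 _ _ _ sy iy).
by rewrite (count0 _ _ _ sx (ltn_trans iy yx)).
Qed.

End Words.

Lemma common_prefix (T : eqType) (s1 s2 : seq T) : exists h r1 r2,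
  [/\ s1 = h ++ r1, s2 = h ++ r2 &
     [\/ r1 = [::], r2 = [::] | exists x1 r1' x2 r2',
         [/\ r1 = x1 :: r1', r2 = x2 :: r2' & x1 != x2]]].
Proof.
elim: s1 s2 => [|x s1 IH] [|y s2].
- by exists [::], [::], [::]; split=> //; constructor 1.
- by exists [::], [::], (y :: s2); split=> //; constructor 1.
- by exists [::], (x :: s1), [::]; split=> //; constructor 2.
have [->|xy] := eqVneq x y.
  have [h [r1 [r2 [-> -> H]]]] := IH s2.
  by exists (y :: h), r1, r2.
exists [::], (x :: s1), (y :: s2); split=> //; constructor 3.
by exists x, s1, y, s2.
Qed.

(** The k-th letter of a subsequence stands at position at least k in [v], and [v] is sorted. *)
Lemma subseq_nth_leq (w v : seq nat) k :
  subseq w v -> sorted leq v -> (k < size w)%N -> (nth 0%N v k <= nth 0%N w k)%N.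
Proof.
elim: v w k => [|y v IH] [|x w] k //=; case: eqP => [->|_] wv yv.
  by case: k => //= k kw; apply: IH; rewrite ?(path_sorted yv).
have min_y := order_path_min leq_trans yv.
case: k => [_|k kw] /=.
  by apply: (allP min_y); apply: (mem_subseq wv); rewrite mem_head.
apply: leq_trans (IH _ k.+1 wv (path_sorted yv) kw).
have kv : (k.+1 < size v)%N := leq_trans kw (size_subseq wv).
have sv := path_sorted yv; rewrite sorted_pairwise in sv; last exact: leq_trans.
by apply: (pairwiseP 0%N sv); rewrite ?inE // ltnW.
Qed.

(** * The spread condition on words of indices *)

Section SpreadWords.
Variables (d : nat) (t : seq nat).

(** When [t] has length [d.-1], the default in [nth 0 t k] is never reached, because
    [k.+1 < size w <= d]. *)
Definition spread (w : seq nat) :=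
  (size w <= d)%N /\
  forall k, (k.+1 < size w)%N -> (nth 0%N w k + nth 0%N t k <= nth 0%N w k.+1)%N.

Lemma spread_sorted w : spread w -> sorted leq w.
Proof.
move=> [_ sw]; apply/(sortedP 0%N) => k /sw; apply: leq_trans.
exact: leq_addr.
Qed.

Lemma spread_take r w : spread w -> spread (take r w).
Proof.
move=> [wd sw]; have takew : (size (take r w) <= size w)%N by rewrite size_take_min geq_minr.
split=> [|k kw]; first exact: leq_trans wd.
have kr : (k.+1 < r)%N.
  by apply: leq_trans kw _; rewrite size_take_min geq_minl.
by rewrite !nth_take ?(ltnW kr) //; apply: sw; exact: leq_trans takew.
Qed.

(** The gaps up to [y] come from [p ++ y :: v], the later ones from [p ++ x :: w], whose gap after
    [x] only widens when [x] is lowered to [y]. *)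
Lemma spread_replace p x y w v : (y <= x)%N ->
  spread (p ++ x :: w) -> spread (p ++ y :: v) -> spread (p ++ y :: w).
Proof.
move=> yx [szx sx] [_ sy]; split=> [|k kw]; first by move: szx; rewrite !size_cat.
have kx : (k.+1 < size (p ++ x :: w))%N by move: kw; rewrite !size_cat.
have [kp|pk] := ltnP k (size p).
  have := sy k; rewrite size_cat /= addnS ltnS (leq_trans kp) ?leq_addr //.
  move=> /(_ isT); rewrite !nth_cat kp; case: ltnP => // pk.
  have -> : k.+1 = size p by apply/eqP; rewrite eqn_leq kp.
  by rewrite subnn.
have := sx k kx; rewrite !nth_cat !ltnNge pk leqW //= subSn //=.
by apply: leq_trans; rewrite leq_add2r; case: (k - size p)%N.
Qed.

End SpreadWords.

(** * Minimal generators of a strongly stable set of monomials *)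

Section StronglyStable.
Variables (n d : nat) (t : seq nat) (P : 'X_{1..n} -> Prop).
Implicit Types (w v p q h : seq 'I_n) (m g u a c : 'X_{1..n}).
Local Notation spread w := (spread d t (map val w)).

Hypothesis P_gen : forall m, P m ->
  exists g, [/\ P g, spread (word g) & (g <= m)%MM].
Hypothesis P_stable : forall p q (x y : 'I_n), (y < x)%N ->
  spread (p ++ x :: q) -> spread (p ++ y :: q) ->
  P (mon_of (p ++ x :: q)) -> P (mon_of (p ++ y :: q)).

Definition min_gen g := P g /\ forall m, P m -> (m <= g)%MM -> m = g.

Lemma min_gen_spread g : min_gen g -> spread (word g).
Proof.
by move=> [Pg ming]; have [g' [Pg' sg' /(ming _ Pg') <-]] := P_gen Pg.
Qed.

(* Replacing the letters of w by those of v from left to right keeps the word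
   spread at every stage. *)
Lemma stable_domination w v p : size w = size v ->
  (forall k, (nth 0%N (map val v) k <= nth 0%N (map val w) k)%N) ->
  spread (p ++ w) -> spread (p ++ v) -> P (mon_of (p ++ w)) -> P (mon_of (p ++ v)).
Proof.
elim: w v p => [|x w IH] [|y v] p //= [] szwv vw spw spv Pw.
have yx : (y <= x)%N := vw 0%N.
have spy : spread (p ++ y :: w).
  move: spw spv; rewrite !map_cat /= => spw spv.
  exact: spread_replace yx spw spv.
have Py : P (mon_of (p ++ y :: w)).
  move: yx; rewrite leq_eqVlt => /orP[/eqP/val_inj->//|yx].
  exact: P_stable yx spw spy Pw.
rewrite -cat_rcons in spy Py; rewrite -cat_rcons in spv; rewrite -cat_rcons.
exact: IH szwv (fun k => vw k.+1) spy spv Py.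
Qed.

(** As [word g] is a subword of [v], its k-th letter is at least that of [v], so [stable_domination]
    applies to the prefix of [v] of the same length. *)
Lemma stable_take g v : spread v -> P g -> spread (word g) ->
  (g <= mon_of v)%MM -> P (mon_of (take (size (word g)) v)).
Proof.
move=> sv Pg sg gv; have gsub := subseq_word (spread_sorted sv) gv.
have sz := size_subseq gsub.
apply: (@stable_domination (word g) _ [::]) => //=.
- by rewrite size_takel.
- move=> k; rewrite map_take; have [kg|gk] := ltnP k (size (word g)).
    rewrite nth_take //; apply: subseq_nth_leq; rewrite ?size_map //.
      exact: map_subseq.
    exact: spread_sorted sv.
  by rewrite nth_default // size_take_min geq_min gk.
- by rewrite map_take; apply: spread_take.
- by rewrite word_mon.
Qed.

(** Induction on length: a proper divisor of [mon_of v] in [P] is divisible by a spread [g] in [P],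
    and by [stable_take] the shorter prefix of length [size (word g)] is in [P]. *)
Lemma prefix_gen v : spread v -> P (mon_of v) ->
  exists r, min_gen (mon_of (take r v)).
Proof.
have [k] := ubnP (size v); elim: k v => // k IH v; rewrite ltnS => vk sv Pv.
have [gv|ngv] := classic (min_gen (mon_of v)).
  by exists (size v); rewrite take_size.
have [m [Pm mv mNv]] : exists m, [/\ P m, (m <= mon_of v)%MM & m <> mon_of v].
  apply: NNPP => H; apply: ngv; split=> // m Pm mv.
  by apply: NNPP => mNv; apply: H; exists m.
have [g [Pg sg gm]] := P_gen Pm.
have gv := lepm_trans gm mv.
have szg : (size (word g) < size v)%N.
  rewrite -!mdeg_mon_of word_mon; apply: leq_ltn_trans (lem_mdeg gm) _.
  rewrite ltnNge; apply/negP => /(lem_mdeg_eq mv); exact: mNv.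
have [| |r] := IH (take (size (word g)) v) _ _ (stable_take sv Pg sg gv).
- by rewrite size_takel ?(ltnW szg) // (leq_trans szg).
- by rewrite map_take; apply: spread_take.
by rewrite -take_min; exists (minn r (size (word g))).
Qed.

Lemma min_gen_quotient a u : min_gen a -> min_gen u -> purelex_gt a u ->
  exists y : 'I_n, (u y < a y)%N /\
    exists c, [/\ min_gen c, purelex_gt c u & (c <= U_(y) + u)%MM].
Proof.
move=> ga gu au; have [sa su] := (min_gen_spread ga, min_gen_spread gu).
have aNu : a <> u by move=> aE; rewrite aE purelex_irr in au.
have [h [ra [ru [aE uE H]]]] := common_prefix (word a) (word u).
have amon : mon_of (h ++ ra) = a by rewrite -aE word_mon.
have umon : mon_of (h ++ ru) = u by rewrite -uE word_mon.
case: H => [r0|r0|[y [ra' [x [ru' [raE ruE xy]]]]]].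
(* If one word is a prefix of the other, one monomial divides the other, against minimality. *)
- by case: aNu; apply: gu.2 ga.1 _; rewrite -amon -umon r0 cats0 mon_of_prefix.
- by case: aNu; symmetry; apply: ga.2 gu.1 _; rewrite -amon -umon r0 cats0 mon_of_prefix.
subst ra ru; rewrite aE in sa; rewrite uE in su.
have [oa ou] := (spread_sorted sa, spread_sorted su).
(* The case [x < y] would make [u] lexicographically greater than [a]. *)
move: xy; rewrite -val_eqE neq_ltn => /orP[yx|xy]; last first.
  have [_ ua] := purelex_mon_of oa ou xy.
  rewrite amon umon in ua.
  by have := purelex_trans au ua; rewrite purelex_irr.
have [] := purelex_mon_of ou oa yx; rewrite amon umon => uy _.
exists y; split=> //.
have sv : spread (h ++ y :: ru').
  move: sa su; rewrite !map_cat /= => sa su.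
  exact: spread_replace (ltnW yx) su sa.
have Pv : P (mon_of (h ++ y :: ru')).
  by apply: P_stable yx su sv _; rewrite umon; exact: gu.1.
have [r gr] := prefix_gen sv Pv.
exists (mon_of (take r (h ++ y :: ru'))); split=> //; last first.
  have cv : (mon_of (take r (h ++ y :: ru')) <= mon_of (h ++ y :: ru'))%MM.
    by rewrite -{2}(cat_take_drop r (h ++ _)) mon_of_prefix.
  apply: lepm_trans cv _.
  rewrite -umon; apply/mnm_lepP => i.
  by rewrite mnmDE !mon_ofE mnm1E !count_cat /= addnCA leq_add2l leq_add2l leq_addl.
(* A prefix ending inside [h] would divide [u] and so equal it, although it is shorter. *)
have [rh|hr] := leqP r (size h).
  have cu : mon_of (take r (h ++ y :: ru')) = u.
    apply: gu.2 gr.1 _; rewrite -umon takel_cat //.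
    by rewrite -{2}(cat_take_drop r h) -catA mon_of_prefix.
  have := congr1 (@mdeg n) cu; rewrite -umon !mdeg_mon_of takel_cat //.
  rewrite size_cat /= size_takel // => rE.
  by move: rh; rewrite rE addnS leqNgt ltnS leq_addr.
have takeE : take r (h ++ y :: ru') = h ++ y :: take (r - size h).-1 ru'.
  by rewrite take_cat ltnNge ltnW //=; move: hr; rewrite -subn_gt0; case: (r - _)%N.
rewrite takeE -umon; apply: (purelex_mon_of ou _ yx).2.
by rewrite -takeE map_take; apply/take_sorted/spread_sorted/sv.
Qed.

End StronglyStable.

(** * From strongly stable ideals to linear quotients and componentwise linearity *)

Lemma bounded_mons (n D : nat) (Q : 'X_{1..n} -> Prop) :
  (forall m, Q m -> (mdeg m <= D)%N) ->
  exists s : seq 'X_{1..n}, forall m, m \in s <-> Q m.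
Proof.
move=> QD.
exists [seq m <- [seq bmnm x | x <- enum {: 'X_{1..n < D.+1}}] |
   if excluded_middle_informative (Q m) then true else false].
move=> m; rewrite mem_filter; case: excluded_middle_informative => //= Qm.
split=> // _; have mD : (mdeg m < D.+1)%N by rewrite ltnS QD.
by apply/mapP; exists (BMultinom mD); rewrite ?mem_enum.
Qed.

Theorem theorem2p2 (K : fieldType) (n d : nat) (hd : (2 <= d)%N)
    (t : d.-1.-tuple nat) (I : {mpoly K[n]} -> Prop)
    (hI : tspread_strongly_stable t I) :
  has_linear_quotients I /\ componentwise_linear I.
Proof.
have [[M Mt IM] stI] := hI; pose P (m : 'X_{1..n}) := I 'X_[m].
have tspreadE (m : 'X_{1..n}) : tspread t m <-> spread d t (map val (word m)).
  rewrite /tspread mon_indices_word; split=> [/andP[md /forallP tm]|[md tm]].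
    split=> // k km; have kd : (k < d.-1)%N.
      by rewrite -ltnS prednK; [exact: leq_trans km md|exact: ltnW].
    by have := implyP (tm (Ordinal kd)) km; rewrite (tnth_nth 0%N).
  rewrite md; apply/forallP => k; apply/implyP => km.
  by rewrite (tnth_nth 0%N) tm.
have tspread_mon w : spread d t (map val w) -> tspread t (@mon_of n w).
  by move=> sw; apply/tspreadE; rewrite word_mon_of //; apply: spread_sorted sw.
have PM m : P m <-> exists2 m', M m' & (m' <= m)%MM by rewrite /P IM mon_idealX.
have P_gen m : P m -> exists g, [/\ P g, spread d t (map val (word g)) & (g <= m)%MM].
  move=> /PM[g Mg gm]; exists g; split=> //; last exact/tspreadE/Mt.
  by apply/PM; exists g => //; exact: lepm_refl.
have P_stable (p q : seq 'I_n) (x y : 'I_n) : (y < x)%N ->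
    spread d t (map val (p ++ x :: q)) -> spread d t (map val (p ++ y :: q)) ->
    P (mon_of (p ++ x :: q)) -> P (mon_of (p ++ y :: q)).
  move=> yx sx sy Px.
  have E : mon_of (p ++ y :: q) = (U_(y) + (mon_of (p ++ x :: q) - U_(x)))%MM.
    apply/mnmP => i; rewrite mnmDE mnmBE !mnm1E !mon_ofE !count_cat /=.
    by rewrite [X in (_ + (X - _))%N]addnCA addKn addnCA.
  rewrite /P E; apply: stI yx _ _ => //; first exact: tspread_mon.
    by rewrite mon_ofE count_cat /= eqxx addnS.
  by rewrite -E; exact: tspread_mon.
(* Minimal generators are spread, hence of degree at most [d], so they form a finite list. *)
have [s0 s0P] : exists s : seq 'X_{1..n}, forall m, m \in s <-> min_gen P m.
  apply: (@bounded_mons n d) => m /(min_gen_spread P_gen)[+ _].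
  by rewrite size_map -mdeg_mon_of word_mon.
have [s sorted_s s_s0] := strict_sort s0 (@purelex_trans n) (@purelex_total n).
have sP m : m \in s <-> min_gen P m by rewrite s_s0.
have quot_s : quotient_list s.
  apply: quotient_list_sorted (@purelex_irr n) (@purelex_trans n) sorted_s _.
  move=> a u /sP ga /sP gu au.
  have [y [uy [c [gc cu cy]]]] := min_gen_quotient P_gen P_stable ga gu au.
  by exists y; split=> //; exists c; split=> //; apply/sP.
have Is f : I f <-> mon_ideal (fun m => m \in s) f.
  rewrite IM !mon_idealP; split=> fP m /fP[g Mg gm].
    have Pg : P g by apply/PM; exists g => //; exact: lepm_refl.
    have [g' [Pg' sg' g'g]] := P_gen g Pg.
    have [|r gr] := prefix_gen P_gen P_stable sg'; first by rewrite word_mon.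
    exists (mon_of (take r (word g'))); first exact/sP.
    apply: lepm_trans gm; apply: lepm_trans g'g.
    by rewrite -{2}(word_mon g') -{2}(cat_take_drop r (word g')) mon_of_prefix.
  have [/PM[g' Mg' g'g] _] := (sP g).1 Mg.
  by exists g' => //; apply: lepm_trans gm.
have anti_s : {in s &, forall a b : 'X_{1..n}, (a <= b)%MM -> a = b}.
  by move=> a b /sP[Pa _] /sP[_ minb]; exact: minb.
split; last by move=> j; exact: (component_linear_resolution anti_s quot_s j Is).
exists s; split=> //; last first.
  move=> k /andP[_ ks]; have [V _ VP] := colon_varsP K (quot_s k ks).
  by exists [set i in V] => f; rewrite -in_vars_ideal -VP.
split=> // [|s' s's Is' m ms].
  exact: sorted_uniq (@purelex_trans n) (@purelex_irr n) _ sorted_s.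
(* A generating sublist contains a divisor [m'] of [m], and minimality of [m] forces [m' = m]. *)
have [Pm minm] := (sP m).1 ms.
have /mon_idealX[m' s'm' m'm] := (Is' _).1 Pm.
suff <- : m' = m by [].
by apply: minm => //; apply: (proj1 ((sP m').1 (s's _ s'm'))).
Qed.
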